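(* Let $p$ be an odd prime, $m\geq 1$ an integer, $p-1=ef$ with $f=2^r$ for some integer $r\geq 1$, and $b\in\mathbb{Z}$. Let $g$ be an odd integer that is a primitive root modulo $p^m$ (hence a common primitive root modulo $p^j$ and $2p^j$ for all $1\le j\le m$). Let $\widetilde{\mathbf{s}}^\infty=\{\widetilde{s}_i\}_{i\ge 0}$ be the binary sequence of period $2p^m$ defined by $\widetilde{s}_i=1$ if $i \bmod 2p^m\in \widetilde{C}_1$ and $\widetilde{s}_i=0$ if $i\bmod 2p^m\in \widetilde{C}_0$, where $$\widetilde{C}_{0}=\bigcup_{j=1}^{m} p^{m-j}\left(\bigcup_{i=0}^{\delta_j-1}2D_{i+b}^{(p^{j})}\ \cup\ \bigcup_{i=\delta_j}^{d_j-1} D_{i+b}^{(2p^{j})}\right)\cup \{p^{m}\},$$ $$\widetilde{C}_{1}=\bigcup_{j=1}^{m} p^{m-j}\left(\bigcup_{i=\delta_j}^{d_j-1}2D_{i+b}^{(p^{j})}\ \cup\ \bigcup_{i=0}^{\delta_j-1}D_{i+b}^{(2p^{j})}\right)\cup\{0\}.$$ Then: (1) if $2^{e}\not\equiv 1\pmod{p}$, then $\mathrm{LC}(\widetilde{\mathbf{s}}^{\infty})=2p^{m}$; (2) if $2^e\equiv 1\pmod{p}$ but $2^e\not\equiv 1\pmod{p^{2}}$, then $2p^m-2(p-1)\leq \mathrm{LC}(\widetilde{\mathbf{s}}^\infty)\leq 2p^m-(p-1)$.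
   Context: For $1\le j\le m$ put $d_j=\varphi(p^j)/e=p^{j-1}f$ and $\delta_j=d_j/2=p^{j-1}f/2$. For $i\in\mathbb{Z}$ and $s=p^j$ or $s=2p^j$, define $D_i^{(s)}=\{g^{i+d_jt} \bmod s : 0\le t<e\}$; it depends only on $i \bmod d_j$. For $(s,a)=(p^j,p^{m-j})$, $(p^j,2p^{m-j})$ or $(2p^j,p^{m-j})$ define $aD_i^{(s)}=\{a g^{i+d_jt}\bmod as : 0\le t<e\}$; thus $p^{m-j}\cdot 2D_i^{(p^j)}=\{2p^{m-j}g^{i+d_jt}\bmod 2p^m\}$ and $p^{m-j}D_i^{(2p^j)}=\{p^{m-j}g^{i+d_jt}\bmod 2p^m\}$. The sets $\widetilde{C}_0$ and $\widetilde{C}_1$ partition $\mathbb{Z}_{2p^m}=\mathbb{Z}/2p^m\mathbb{Z}$. The linear complexity $\mathrm{LC}(\mathbf{s}^\infty)$ of a binary sequence $\mathbf{s}^\infty=\{s_i\}_{i\geq 0}$ ($s_i\in\mathbb{F}_2$) of period $N$ is the smallest positive integer $l$ for which there are constants $c_1,\dots,c_l\in\mathbb{F}_2$ with $s_i=c_1s_{i-1}+c_2s_{i-2}+\cdots+c_ls_{i-l}$ for all $i\ge l$. Equivalently, $\mathrm{LC}(\mathbf{s}^\infty)=N-\deg\gcd(x^N-1,\ s_0+s_1x+\cdots+s_{N-1}x^{N-1})$, with the gcd taken in $\mathbb{F}_2[x]$. *)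

(* Defs.v *)
From HB Require Import structures.
From mathcomp Require Import all_boot all_order all_algebra.
Set Implicit Arguments.
Unset Strict Implicit.
Unset Printing Implicit Defensive.
Import Order.TTheory GRing.Theory Num.Theory.
Local Open Scope ring_scope.

Definition dj (p e j : nat) : nat := (totient (p ^ j) %/ e)%N.

Definition deltaj (p e j : nat) : nat := (dj p e j %/ 2)%N.

(** D_i^(s), with j the exponent of p in s (s = p^j or 2p^j).  The exponent is
    a signed integer: for a negative exponent the power is that of the inverse
    of g in Z/s, which exists since g is coprime to s. *)
Definition Dclass (p e : nat) (g : int) (j s : nat) (i : int) : {set 'Z_s} :=
  [set (g%:~R : 'Z_s) ^ (i + (dj p e j * t)%:Z) | t : 'I_e].

(** The set {a x mod N : x in A}; it does not depend on the representatives x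
    because it is only used when N = a * s. *)
Definition dilate (N a s : nat) (A : {set 'Z_s}) : {set 'Z_N} :=
  [set ((a * x)%:R : 'Z_N) | x : 'Z_s in A].

(** p^(m-j) . 2 D_i^(p^j) *)
Definition evenD (p m e : nat) (g : int) (j : nat) (i : int) :
    {set 'Z_(2 * p ^ m)} :=
  dilate (2 * p ^ m) (2 * p ^ (m - j)) (Dclass p e g j (p ^ j) i).

(** p^(m-j) . D_i^(2p^j) *)
Definition oddD (p m e : nat) (g : int) (j : nat) (i : int) :
    {set 'Z_(2 * p ^ m)} :=
  dilate (2 * p ^ m) (p ^ (m - j)) (Dclass p e g j (2 * p ^ j) i).

Definition C0 (p m e : nat) (g b : int) : {set 'Z_(2 * p ^ m)} :=
  (\bigcup_(1 <= j < m.+1)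
     ((\bigcup_(0 <= i < deltaj p e j) evenD p m e g j (i%:Z + b)) :|:
      (\bigcup_(deltaj p e j <= i < dj p e j) oddD p m e g j (i%:Z + b))))
  :|: [set (p ^ m)%:R].

Definition C1 (p m e : nat) (g b : int) : {set 'Z_(2 * p ^ m)} :=
  (\bigcup_(1 <= j < m.+1)
     ((\bigcup_(deltaj p e j <= i < dj p e j) evenD p m e g j (i%:Z + b)) :|:
      (\bigcup_(0 <= i < deltaj p e j) oddD p m e g j (i%:Z + b))))
  :|: [set 0].

(** [c k] is the coefficient usually written c_(k+1). *)
Definition satisfies_recurrence (s : nat -> 'F_2) (l : nat) : Prop :=
  exists c : 'I_l -> 'F_2,
    forall i : nat, (l <= i)%N -> s i = \sum_(k < l) c k * s (i - k.+1)%N.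

(** L is the linear complexity of s; such an L is unique, and it exists as soon
    as s is periodic. *)
Definition is_linear_complexity (s : nat -> 'F_2) (L : nat) : Prop :=
  [/\ (0 < L)%N, satisfies_recurrence s L &
      forall l : nat, (0 < l)%N -> satisfies_recurrence s l -> (L <= l)%N].

(* Main.v *)
(** Write P = p^m, let S be the polynomial of one period, so that the linear
    complexity is 2P - deg gcd(X^(2P) - 1, S) with X^(2P) - 1 = (X^P - 1)^2 over
    F_2.  By the Chinese remainder theorem Z/2P is an even and an odd copy of
    Z/P.  If chi is the indicator of C_1 on the odd copy, then y |-> 1 + chi(y)
    is the indicator at 2y on the even one, so that for x^P = 1, x <> 1,
      S(x) = eta(x)^2 + eta(x)   with   eta(x) = sum_y chi(y) x^y,
    while S(1) = 1.  Hence S(x) = 0 iff eta is fixed by x |-> x^2.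

    If 2^e <> 1 mod p, then, f being a power of 2, some power w of 2 has index
    congruent to half a period modulo d_m.  Multiplication by w complements chi
    away from 0, so eta(x^w) = eta(x) + 1 and x is not a root of S.

    If 2^e = 1 mod p and x^p = 1, then x^2 = x^w with w = 2^(p^(m-1)), whose
    index is divisible by d_m; so x is a root of S.  If moreover 2^e <> 1 mod
    p^2, the powers of 2 fill the residues 1 mod p.  When x has order p^k with
    k >= 2 and eta(x) is fixed, Fourier inversion over these residues gives
    sum chi(y) x^y = 0 over y = g^b mod p^(k-1), and this is, up to a unit, the
    geometric sum of (q+1)/2 powers of a primitive p-th root of unity, where
    q = p^(m-k+1); it does not vanish.  So only the roots of
    1 + X + ... + X^(p-1), with multiplicity at most 2, are cancelled. *)

Require Import Defs.
From HB Require Import structures.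
From mathcomp Require Import all_boot all_order all_algebra.
From mathcomp Require Import cyclic closed_field cyclotomic separable zify.
Set Implicit Arguments.
Unset Strict Implicit.
Unset Printing Implicit Defensive.
Import Order.TTheory GRing.Theory Num.Theory.
Local Open Scope ring_scope.

Definition window (s : nat -> 'F_2) (N j : nat) : {poly 'F_2} :=
  \poly_(i < N) s (i + j)%N.

Section LinearComplexity.

Variables (s : nat -> 'F_2) (N : nat).
Hypotheses (N_gt0 : (0 < N)%N) (s_per : forall i, s (i + N)%N = s i).

Local Notation S := (window s N).

Lemma mulX_window j : 'X * S j.+1 = S j + (s j)%:P * ('X^N - 1).
Proof.
have -> : 'X * S j.+1 = \sum_(i < N) s (i.+1 + j)%N *: 'X ^+ i.+1.
  rewrite /window poly_def mulr_sumr; apply: eq_bigr => i _.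
  by rewrite -scalerAr -exprS addSnnS.
rewrite /window poly_def; case: N N_gt0 s_per => // n _ per.
rewrite big_ord_recr big_ord_recl /= expr0 addnC per add0n.
rewrite (eq_bigr (fun i : 'I_n => s (bump 0 i + j)%N *: 'X^(bump 0 i))) //.
rewrite mulrBr mulr1 mul_polyC -alg_polyC.
by rewrite [RHS]addrC addrA subrK addrC.
Qed.

Lemma dvdp_mulXn_window n j : 'X^N - 1 %| 'X^n * S (j + n)%N - S j.
Proof.
elim: n => [|n IHn]; first by rewrite expr0 mul1r addn0 subrr dvdp0.
rewrite addnS exprSr -mulrA mulX_window mulrDr addrAC dvdp_addr //.
by rewrite mulrA dvdp_mull.
Qed.

Lemma window_mulN k : S (k * N)%N = S 0%N.
Proof.
rewrite /window; apply/polyP => i; rewrite !coef_poly addn0; case: ifP => // _.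
by elim: k => [|k IHk]; rewrite ?addn0 // mulSn addnCA addnC s_per.
Qed.

Lemma dvdp_window_X j : 'X^N - 1 %| S j - 'X^(j * N.-1) * S 0%N.
Proof.
have -> : S 0%N = S (j + j * N.-1)%N by rewrite -mulnS prednK // window_mulN.
by rewrite -dvdpNr opprB dvdp_mulXn_window.
Qed.

Lemma recurrence_of_dvdp (C : {poly 'F_2}) :
    'X^N - 1 %| C * S 0%N ->
  forall j, \sum_(k < size C) C`_k * s (j + (size C).-1 - k)%N = 0.
Proof.
move=> dvC j; set l := (size C).-1.
have dvl : 'X^N - 1 %| C * S (j + l)%N.
  rewrite -(subrK ('X^((j + l) * N.-1) * S 0%N) (S (j + l)%N)) mulrDr.
  apply: dvdp_add; first by rewrite dvdp_mull ?dvdp_window_X.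
  by rewrite mulrCA dvdp_mull.
have dv : 'X^N - 1 %| \sum_(k < size C) C`_k *: S (j + l - k)%N.
  rewrite -(dvdp_subr _ dvl) -{1}[C]coefK poly_def mulr_suml -sumrB.
  apply: (big_ind (dvdp _)) => [|q q'|k _]; [exact: dvdp0|exact: dvdp_add|].
  rewrite -scalerAl -scalerBr -mul_polyC dvdp_mull //.
  have lekl : (k <= j + l)%N.
    have lek n : (k < n)%N -> (k <= n.-1)%N by case: n.
    exact: leq_trans (lek _ (ltn_ord k)) (leq_addl _ _).
  by rewrite -{1}(subnK lekl) dvdp_mulXn_window.
have : \sum_(k < size C) C`_k *: S (j + l - k)%N = 0.
  apply: contraTeq dv => nz; rewrite gtNdvdp // size_Xn_sub_1 // ltnS.
  apply: leq_trans (size_sum _ _ _) _; apply/bigmax_leqP => k _.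
  exact: leq_trans (size_scale_leq _ _) (size_poly _ _).
move/(congr1 (fun q : {poly 'F_2} => q`_0)); rewrite coef0 coef_sum => sum0.
rewrite -[RHS]sum0; apply: eq_bigr => k _; by rewrite coefZ coef_poly N_gt0.
Qed.

Lemma dvdp_of_recurrence l (c : 'I_l -> 'F_2) :
    (forall i, (l <= i)%N -> s i = \sum_(k < l) c k * s (i - k.+1)%N) ->
  'X^N - 1 %| (1 - \sum_(k < l) c k *: 'X ^+ k.+1) * S 0%N.
Proof.
move=> rec; rewrite mulrBl mul1r mulr_suml.
have dvk k : (k <= l * N)%N -> 'X^N - 1 %| 'X^k * S 0%N - S (l * N - k)%N.
  by move=> lek; rewrite -(window_mulN l) -{1}(subnK lek) dvdp_mulXn_window.
have {1}-> : S 0%N = \sum_(k < l) c k *: S (l * N - k.+1)%N.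
  apply/polyP => i; rewrite -(window_mulN l) coef_sum coef_poly.
  case: ifP => ltiN; last first.
    by rewrite big1 // => k _; rewrite coefZ coef_poly ltiN mulr0.
  have leN : (l <= l * N)%N by rewrite leq_pmulr.
  rewrite rec ?(leq_trans leN) ?leq_addl //; apply: eq_bigr => k _.
  by rewrite coefZ coef_poly ltiN addnBA // (leq_trans _ leN).
rewrite -sumrB.
apply: (big_ind (dvdp _)) => [|q q'|k _]; [exact: dvdp0|exact: dvdp_add|].
rewrite -scalerAl -scalerBr -mul_polyC dvdp_mull //.
rewrite -dvdpNr opprB dvk // (leq_trans (ltn_ord k)) // leq_pmulr //.
Qed.

Lemma linear_complexity_gcdp :
    S 0%N != 0 ->
  is_linear_complexity s (N - (size (gcdp ('X^N - 1) (S 0%N))).-1)%N.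
Proof.
set A : {poly 'F_2} := 'X^N - 1; set G := gcdp A (S 0%N) => S_nz.
have szA : size A = N.+1 by rewrite size_Xn_sub_1.
have A_nz : A != 0 by rewrite -size_poly_eq0 szA.
have G_nz : G != 0 by rewrite gcdp_eq0 (negPf A_nz).
have GA : G %| A := dvdp_gcdl _ _.
have GS : G %| S 0%N := dvdp_gcdr _ _.
have szG : ((size G).-1 < N)%N.
  rewrite prednK ?lt0n ?size_poly_eq0 //.
  exact: leq_trans (dvdp_leq S_nz GS) (size_poly _ _).
have szAG : size (A %/ G) = (N - (size G).-1).+1.
  by rewrite size_divp // szA subSn // ltnW.
split; first by rewrite subn_gt0.
- set l := (N - _)%N in szAG *; set C := A %/ G in szAG *.
  have dvC : A %| C * S 0%N.
    by rewrite -[X in X %| _](divpK GA) dvdp_mul.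
  have C0 : C`_0 = 1.
    have : (C * G)`_0 != 0.
      by rewrite divpK // coefB coefXn coef1 eqxx; case: N N_gt0.
    rewrite coef0M mulf_eq0 negb_or => /andP[+ _].
    by case: (C`_0) => -[|[|[]]] //= ? ?; apply/val_inj.
  exists (fun k => - C`_k.+1) => i leli.
  have := recurrence_of_dvdp dvC (i - l)%N.
  rewrite szAG big_ord_recl /= C0 mul1r.
  rewrite subnK // subn0 => /eqP; rewrite addr_eq0 => /eqP ->; rewrite -sumrN.
  by apply: eq_bigr => k _; rewrite mulNr.
- move=> l _ [c /dvdp_of_recurrence]; set C := (1 - _) => dvC.
  have C_nz : C != 0.
    apply/eqP => /(congr1 (fun q : {poly 'F_2} => q`_0)) /eqP.
    rewrite coefB coef1 coef_sum big1 ?subr0 ?coef0 ?oner_eq0 // => k _.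
    by rewrite coefZ coefXn mulr0.
  have szC : (size C <= l.+1)%N.
    rewrite (leq_trans (size_polyD _ _)) // geq_max size_poly1 size_polyN /=.
    apply: leq_trans (size_sum _ _ _) _; apply/bigmax_leqP => k _.
    rewrite (leq_trans (size_scale_leq _ _)) //.
    by rewrite size_polyXn !ltnS.
  have : A %/ G %| C.
    rewrite -(@Gauss_dvdpl _ C (S 0%N %/ G)) ?coprimep_div_gcd ?S_nz ?orbT //.
    by rewrite -(dvdp_mul2r _ _ G_nz) -mulrA !divpK.
  by move/(dvdp_leq C_nz)/leq_trans/(_ szC); rewrite szAG ltnS.
Qed.

End LinearComplexity.

Section Congruences.

Local Open Scope nat_scope.

Lemma eqn_mod_mul2l a b c d :
  0 < a -> (a * b == a * c %[mod a * d]) = (b == c %[mod d]).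
Proof. by move=> a_gt0; rewrite -!muln_modr // eqn_pmul2l. Qed.

Lemma expn_pX_eq1_mod p j i a :
  1 < p -> a = 1 %[mod p ^ j.+1] -> a ^ p ^ i = 1 %[mod p ^ (j + i).+1].
Proof.
move=> p_gt1; elim: i a j => [|i IHi] a j aE; first by rewrite addn0.
rewrite expnS expnM addnS -addSn; apply: IHi.
have a_gt0 : 0 < a.
  by case: a aE => //; rewrite mod0n modn_small // -{1}(exp1n j.+1) ltn_exp2r.
apply/eqP; rewrite eqn_mod_dvd ?expn_gt0 ?a_gt0 // subn1 predn_exp expnSr.
apply: dvdn_mul; first by move/eqP: aE; rewrite eqn_mod_dvd // subn1.
have aE1 : a = 1 %[mod p].
  by have /(congr1 (modn^~ p)) := aE; rewrite expnS !modn_dvdm ?dvdn_mulr.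
rewrite /dvdn -modn_summ (eq_bigr (fun=> 1 %% p)) => [|k _].
  by rewrite modn_summ sum_nat_const card_ord muln1 modnn.
by rewrite -modnXm aE1 modnXm exp1n.
Qed.

Lemma eqn_mod_coprime_mul2l w x y d :
  coprime w d -> (w * x == w * y %[mod d]) = (x == y %[mod d]).
Proof.
move=> cwd; wlog lexy : x y / x <= y => [W|].
  by case/orP: (leq_total x y) => /W // E; rewrite eq_sym E eq_sym.
rewrite eq_sym [RHS]eq_sym !eqn_mod_dvd ?leq_mul // -mulnBr Gauss_dvdr //.
by rewrite coprime_sym.
Qed.

Lemma sum_coprime_mul (V : nmodType) (F : nat -> V) P w :
    0 < P -> coprime w P -> (forall x y, x = y %[mod P] -> F x = F y) ->
  (\sum_(y < P) F (w * y)%N = \sum_(y < P) F y)%R.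
Proof.
case: P => // P _ cwP F_per.
pose h (y : 'I_P.+1) : 'I_P.+1 := inord (w * y %% P.+1).
have hE y : h y = w * y %% P.+1 :> nat by rewrite inordK ?ltn_mod.
have h_inj : injective h.
  move=> x y /(congr1 val) /=; rewrite !hE.
  by move/eqP; rewrite eqn_mod_coprime_mul2l // !modn_small // => /eqP/val_inj.
rewrite [RHS](reindex_inj h_inj); apply: eq_bigr => y _.
by apply: F_per; rewrite hE modn_mod.
Qed.

Lemma linear_mod_solvable a h q :
  0 < q -> coprime a q -> exists n, a * n = h %[mod q].
Proof.
move=> q_gt0 caq; exists (a ^ (totient q).-1 * h).
rewrite mulnA -expnS prednK ?totient_gt0 // -modnMml Euler_exp_totient //.
by rewrite modnMml mul1n.
Qed.

Section PrimitiveRoot.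

Variables p m g : nat.
Hypotheses (p_pr : prime p) (m_gt0 : 0 < m).
Hypothesis g_ord : forall n, (g ^ n == 1 %[mod p ^ m]) = (totient (p ^ m) %| n).

Let p_gt0 : 0 < p := prime_gt0 p_pr.

Lemma primroot_coprime : coprime g p.
Proof.
rewrite coprime_sym prime_coprime //; apply/negP => p_g.
have := dvdnn (totient (p ^ m)); rewrite -g_ord => /eqP.
have tot_gt0 : 0 < totient (p ^ m) by rewrite totient_gt0 expn_gt0 p_gt0.
move=> /(congr1 (modn^~ p)); rewrite !modn_dvdm ?dvdn_exp //.
have /eqP -> : p %| g ^ totient (p ^ m) by rewrite dvdn_exp.
by rewrite modn_small ?prime_gt1.
Qed.

Lemma primroot_coprimeX n j : coprime (g ^ n) (p ^ j).
Proof. by rewrite coprimeXl ?coprimeXr ?primroot_coprime. Qed.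

Lemma primroot_eq1 j n : 0 < j <= m ->
  (g ^ n == 1 %[mod p ^ j]) = (totient (p ^ j) %| n).
Proof.
case: j => // j /andP[_ lejm]; apply/eqP/idP => [gnE|/dvdnP[k ->]]; last first.
  rewrite mulnC expnM -modnXm Euler_exp_totient ?modnXm ?exp1n //.
  by rewrite coprimeXr ?primroot_coprime.
have := expn_pX_eq1_mod (m - j.+1) (prime_gt1 p_pr) gnE.
rewrite -addSn subnKC // -expnM => /eqP.
rewrite g_ord -{1}(subnKC lejm) !totient_pfactor ?addSn //= expnD mulnA.
by rewrite dvdn_pmul2r ?expn_gt0 ?p_gt0.
Qed.

Lemma primroot_eq j n n' : 0 < j <= m ->
  (g ^ n == g ^ n' %[mod p ^ j]) = (n == n' %[mod totient (p ^ j)]).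
Proof.
move=> jm; wlog lenn : n n' / n' <= n => [W|].
  by case/orP: (leq_total n' n) => /W // E; rewrite eq_sym E eq_sym.
rewrite [RHS]eqn_mod_dvd // -primroot_eq1 //.
rewrite -{1}(subnK lenn) addnC expnD -{2}[g ^ n']muln1.
by rewrite eqn_mod_coprime_mul2l ?primroot_coprimeX.
Qed.

Lemma primroot_surj u : coprime u p -> exists n, u = g ^ n %[mod p ^ m].
Proof.
move=> cup; set P := p ^ m; set t := totient P.
have P_gt0 : 0 < P by rewrite expn_gt0 p_gt0.
case E: P P_gt0 => [|P'] // _.
pose h (n : 'I_t) : 'I_P'.+1 := inord (g ^ n %% P'.+1).
have hE n : h n = g ^ n %% P'.+1 :> nat by rewrite inordK ?ltn_mod.
have h_inj : injective h.
  move=> x y /(congr1 val) /=; rewrite !hE -E => /eqP.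
  rewrite primroot_eq ?m_gt0 ?leqnn // -/P -/t !modn_small //.
  by move/eqP/val_inj.
pose A := [set x : 'I_P'.+1 | coprime x P'.+1].
have cardA : #|A| = t.
  rewrite /t E totient_count_coprime big_mkord -sum1dep_card big_mkcond /=.
  by apply: eq_bigr => i _; rewrite coprime_sym; case: coprime.
have : h @: setT = A.
  apply/eqP; rewrite eqEcard cardA card_imset // cardsT card_ord leqnn andbT.
  apply/subsetP => _ /imsetP[n _ ->]; rewrite inE hE coprime_modl -E.
  exact: primroot_coprimeX.
move=> hA; have : inord (u %% P'.+1) \in A.
  by rewrite inE inordK ?ltn_mod // coprime_modl -E coprimeXr.
rewrite -hA => /imsetP[n _ /(congr1 val)] /=.
by rewrite inordK ?ltn_mod // hE; exists n.
Qed.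

Lemma primroot_residue B y : ~~ (p ^ m %| y) ->
  exists j, exists2 n, 0 < j <= m & y = p ^ (m - j) * g ^ (B + n) %[mod p ^ m].
Proof.
move=> Py; have y_gt0 : 0 < y by rewrite lt0n; apply: contraNneq Py => ->.
have [u pu yE] := pfactor_coprime p_pr y_gt0; set l := logn p y in yE.
have ltlm : l < m.
  by rewrite ltnNge; apply: contra Py => leml; rewrite yE dvdn_mull ?dvdn_exp2l.
have cup : coprime u p by rewrite coprime_sym.
have [n uE] := primroot_surj cup.
exists (m - l), (n + B * (totient (p ^ m)).-1).
  by rewrite subn_gt0 ltlm leq_subr.
rewrite subKn ?(ltnW ltlm) // {1}yE mulnC -modnMmr uE -[in RHS]modnMmr.
congr (_ * _ %% _); apply/eqP; rewrite primroot_eq ?m_gt0 ?leqnn //.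
rewrite addnCA -mulnS prednK ?modnMDl 1?addnC ?modnMDl //.
by rewrite totient_gt0 expn_gt0 p_gt0.
Qed.
End PrimitiveRoot.

End Congruences.

Lemma sum_unity_root (K : fieldType) (P : nat) (x : K) :
  x ^+ P = 1 -> x != 1 -> \sum_(y < P) x ^+ y = 0.
Proof.
move=> xP x1; apply/eqP; rewrite -(mulrI_eq0 _ (mulfI (_ : x - 1 != 0))).
  by rewrite -subrX1 xP subrr.
by rewrite subr_eq0.
Qed.

Lemma natr_odd_pchar2 (R : nzRingType) n :
  2 \in [pchar R] -> odd n -> n%:R = 1 :> R.
Proof.
move=> R2 n_odd; rewrite -(odd_double_half n) n_odd natrD -mul2n natrM.
by rewrite (pcharf0 R2) mul0r addr0.
Qed.

Lemma eqn_mod_expr (K : fieldType) (P : nat) (x : K) (i j : nat) :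
  x ^+ P = 1 -> i = j %[mod P] -> x ^+ i = x ^+ j.
Proof. by move=> xP ij; rewrite -(expr_mod i xP) ij expr_mod. Qed.

Lemma unity_root_neq0 (K : fieldType) (P : nat) (x : K) :
  (0 < P)%N -> x ^+ P = 1 -> x != 0.
Proof.
move=> P_gt0 xP; apply/eqP => x0; have /eqP := xP.
by rewrite x0 expr0n gtn_eqF // eq_sym oner_eq0.
Qed.

Definition indicator_sum (K : fieldType) (P : nat) (chi : nat -> bool)
    (x : K) : K :=
  \sum_(y < P) (chi y)%:R * x ^+ y.

Section HalfSum.

Variables p m e r g B : nat.
Let P := (p ^ m)%N.
Let delta j := (p ^ j.-1 * 2 ^ r.-1)%N.
Hypotheses (p_pr : prime p) (p_odd : odd p) (m_gt0 : (0 < m)%N).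
Hypotheses (r_gt0 : (0 < r)%N) (p_er : (p.-1 = e * 2 ^ r)%N).
Hypothesis g_ord : forall n,
  (g ^ n == 1 %[mod p ^ m])%N = (totient (p ^ m) %| n)%N.

Variable chi : nat -> bool.
Hypothesis chi_mod : forall x y, (x = y %[mod p ^ m])%N -> chi x = chi y.
Hypothesis chi0 : chi 0%N = false.
(* As d_j = 2 delta_j, the right-hand side says that n mod d_j < delta_j. *)
Hypothesis chi_primroot : forall j n, (0 < j <= m)%N ->
  chi (p ^ (m - j) * g ^ (B + n))%N = ~~ odd (n %/ (p ^ j.-1 * 2 ^ r.-1)).

Let p_gt0 : (0 < p)%N := prime_gt0 p_pr.
Let P_gt0 : (0 < P)%N.
Proof. by rewrite expn_gt0 p_gt0. Qed.
Let delta_gt0 j : (0 < delta j)%N.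
Proof. by rewrite muln_gt0 !expn_gt0 p_gt0. Qed.

Lemma chi_shift k y :
  chi (g ^ (k * delta m) * y)%N = (odd k && ~~ (P %| y)%N) (+) chi y.
Proof.
have [Py|Py] /= := boolP (P %| y)%N.
  rewrite andbF; apply: chi_mod; move/eqP: (Py); rewrite -/P => ->.
  by apply/eqP; rewrite -/(dvdn _ _) dvdn_mull.
have [j [n jm yE]] := primroot_residue p_pr m_gt0 g_ord B Py.
have -> : chi (g ^ (k * delta m) * y)%N
        = chi (p ^ (m - j) * g ^ (B + (k * delta m + n)))%N.
  by apply: chi_mod; rewrite -modnMmr yE modnMmr addnCA
    [(g ^ (k * _ + _))%N]expnD mulnCA.
rewrite (chi_mod yE) !chi_primroot // -/(delta j).
have -> : (delta m = p ^ (m - j) * delta j)%N.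
  rewrite /delta mulnA -expnD; congr (p ^ _ * _)%N.
  by case/andP: jm; lia.
rewrite mulnA divnMDl // oddD oddM oddX p_odd orbT !andbT.
by case: (odd k); case: (odd _).
Qed.

Variable K : fieldType.
Hypothesis K2 : 2 \in [pchar K].

Local Notation eta := (@indicator_sum K P chi).

Lemma indicator_sum_sqr x : eta x ^+ 2 = eta (x ^+ 2).
Proof.
rewrite -(pFrobenius_autE K2) rmorph_sum; apply: eq_bigr => y _ /=.
rewrite pFrobenius_autE exprMn -!exprM mulnC.
by case: (chi y); rewrite ?expr1n ?expr0n.
Qed.

Lemma indicator_sum_fixed x c :
  eta x ^+ 2 = eta x -> eta (x ^+ (2 ^ c)) = eta x.
Proof.
move=> fix_x; elim: c => [|c IHc]; first by rewrite expr1.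
by rewrite expnSr exprM -indicator_sum_sqr IHc.
Qed.

Lemma indicator_sum_reindex x a :
  x ^+ P = 1 -> eta x = \sum_(y < P) (chi (g ^ a * y))%:R * (x ^+ (g ^ a)) ^+ y.
Proof.
move=> xP; pose F y := (chi y)%:R * x ^+ y.
rewrite -[eta x](@sum_coprime_mul _ F P (g ^ a)) //.
- by apply: eq_bigr => y _; rewrite -exprM.
- exact: (primroot_coprimeX p_pr m_gt0 g_ord).
- by move=> y z yz; rewrite /F (chi_mod yz) (eqn_mod_expr xP yz).
Qed.

Lemma indicator_sum_even_shift x k : x ^+ P = 1 -> ~~ odd k ->
  eta (x ^+ (g ^ (k * delta m))) = eta x.
Proof.
move=> xP /negPf k_even; rewrite (indicator_sum_reindex (k * delta m) xP).
by apply: eq_bigr => y _; rewrite chi_shift k_even.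
Qed.

Lemma indicator_sum_odd_shift x k : x ^+ P = 1 -> x != 1 -> odd k ->
  eta x - eta (x ^+ (g ^ (k * delta m))) = 1.
Proof.
move=> xP x1 k_odd; rewrite (indicator_sum_reindex (k * delta m) xP) -sumrB.
set a := (k * _)%N; have caP : coprime (g ^ a) P.
  exact: (primroot_coprimeX p_pr m_gt0 g_ord).
have: \sum_(y < P) (x ^+ (g ^ a)) ^+ y = 0.
  under eq_bigr => y _ do rewrite -exprM.
  rewrite (sum_coprime_mul (F := fun y => x ^+ y)) ?sum_unity_root //.
  by move=> y z; exact: eqn_mod_expr.
have N1 : -1 = 1 :> K by apply: oppr_pchar2.
move: P_gt0 chi_shift; rewrite /indicator_sum -/P; case: (P) => // n _ shift.
rewrite !big_ord_recl expr0 /= => /eqP.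
rewrite addrC addr_eq0 N1 => /eqP sum1; rewrite -[RHS]sum1.
rewrite shift dvdn0 andbF addFb chi0 subrr add0r; apply: eq_bigr => y _.
rewrite -/a shift k_odd gtnNdvd /bump ?ltnS ?ltn_ord // -mulrBl.
by case: (chi _); rewrite /= ?subr0 ?sub0r ?N1 mul1r.
Qed.

Lemma half_period_of_two a : (2 = g ^ a %[mod P])%N -> ~~ (2 ^ r %| a)%N ->
  exists c, exists2 k, odd k & (2 ^ c = g ^ (k * delta m) %[mod P])%N.
Proof.
move=> aE Na.
have a_gt0 : (0 < a)%N by rewrite lt0n; apply: contraNneq Na => ->.
have [k ck kE] := pfactor_coprime (isT : prime 2) a_gt0.
set t := logn 2 a in kE.
have ltr : (t < r)%N.
  by rewrite ltnNge; apply: contra Na => ?; rewrite kE dvdn_mull // dvdn_exp2l.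
exists (2 ^ (r.-1 - t) * p ^ m.-1)%N, k; first by rewrite -coprime2n.
have -> : (k * delta m = a * (2 ^ (r.-1 - t) * p ^ m.-1))%N.
  rewrite /delta; have {1}-> : (r.-1 = t + (r.-1 - t))%N by lia.
  by rewrite kE expnD; lia.
by rewrite -modnXm aE modnXm -expnM.
Qed.

Lemma indicator_sum_not_fixed x a : x ^+ P = 1 -> x != 1 ->
  (2 = g ^ a %[mod P])%N -> ~~ (2 ^ r %| a)%N -> eta x ^+ 2 != eta x.
Proof.
move=> xP x1 aE Na; have [c [k k_odd cE]] := half_period_of_two aE Na.
apply/eqP => /(indicator_sum_fixed c) cfix.
have /eqP := indicator_sum_odd_shift xP x1 k_odd.
by rewrite -(eqn_mod_expr xP cE) cfix subrr eq_sym oner_eq0.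
Qed.

Lemma indicator_sum_fixed_order_p x a : x ^+ p = 1 ->
  (2 = g ^ a %[mod P])%N -> (2 ^ r %| a)%N -> eta x ^+ 2 = eta x.
Proof.
move=> xp aE /dvdnP[k kE]; have xP : x ^+ P = 1.
  by rewrite /P -(prednK m_gt0) expnS exprM xp expr1n.
rewrite indicator_sum_sqr -(@indicator_sum_even_shift x (k * 2)) //; last first.
  by rewrite oddM andbF.
congr eta; have -> : (k * 2 * delta m = a * p ^ m.-1)%N.
  by rewrite kE /delta -(prednK r_gt0) expnS /=; lia.
rewrite expnM.
have: (2 ^ p ^ m.-1 = g ^ (a * p ^ m.-1) %[mod P])%N.
  by rewrite expnM -modnXm aE modnXm.
rewrite -expnM => /(eqn_mod_expr xP) <-; apply: eqn_mod_expr xp _.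
elim: (m.-1) => [|i IHi]; rewrite ?expn1 // expnSr expnM.
by rewrite -modnXm -IHi modnXm fermat_little.
Qed.

Lemma primroot_coset_sum (V : nmodType) (F : nat -> V) i t :
    (0 < i <= m)%N -> coprime t p ->
    (forall x y, (x = y %[mod P])%N -> F x = F y) ->
  \sum_(y < P | (y == g ^ B %[mod p ^ i])%N) F y =
    \sum_(z < p ^ (m - i)) F (g ^ (B + totient (p ^ i) * (t * z)))%N.
Proof.
move=> im ctp F_mod; have [i_gt0 leim] := andP im.
set q := (p ^ (m - i))%N; set phi := totient (p ^ i).
have q_gt0 : (0 < q)%N by rewrite expn_gt0 p_gt0.
have phi_gt0 : (0 < phi)%N by rewrite totient_gt0 expn_gt0 p_gt0.
have phiP : (totient P = phi * q)%N.
  rewrite /P /phi !totient_pfactor // -mulnA -expnD; congr (_ * _ ^ _)%N; lia.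
have ctq : coprime t q by rewrite coprimeXr.
have gP n n' : (g ^ n == g ^ n' %[mod P])%N = (n == n' %[mod phi * q])%N.
  by rewrite -phiP (primroot_eq p_pr m_gt0 g_ord) ?m_gt0 ?leqnn.
have gi n n' : (g ^ n == g ^ n' %[mod p ^ i])%N = (n == n' %[mod phi])%N.
  exact: (primroot_eq p_pr m_gt0 g_ord).
move: P_gt0 gP F_mod; have : (p ^ i %| P)%N by rewrite dvdn_exp2l.
have : forall u, coprime u p -> exists n, (u = g ^ n %[mod P])%N.
  exact: (primroot_surj p_pr m_gt0 g_ord).
case: (P) => // P' surj piP _ gP F_mod.
pose h (z : 'I_q) : 'I_P'.+1 := inord (g ^ (B + phi * (t * z)) %% P'.+1).
have hE z : h z = (g ^ (B + phi * (t * z)) %% P'.+1)%N :> nat.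
  by rewrite inordK ?ltn_mod.
have h_inj : injective h.
  move=> y z /(congr1 val) /=; rewrite !hE => /eqP.
  rewrite gP eqn_modDl eqn_mod_mul2l // eqn_mod_coprime_mul2l //.
  by rewrite !modn_small // => /eqP/val_inj.
rewrite (eq_bigl (mem (h @: setT))) => [|y]; last first.
  apply/idP/imsetP => [/eqP yE | [z _ ->]]; last first.
    by rewrite hE modn_dvdm // gi -{2}[B]addn0 eqn_modDl mod0n modnMr.
  have [|n yn] := surj y.
    rewrite -(coprime_pexpr _ _ i_gt0) -coprime_modl yE coprime_modl.
    exact: (primroot_coprimeX p_pr m_gt0 g_ord).
  have: (g ^ n == g ^ B %[mod p ^ i])%N.
    by rewrite -yE -(modn_dvdm y piP) yn modn_dvdm.
  have leBn : (B <= n + B * (phi * q))%N.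
    by apply: leq_trans (leq_addl _ _); rewrite leq_pmulr // muln_gt0 phi_gt0.
  have nE : (n + B * (phi * q) = n %[mod phi * q])%N by rewrite addnC modnMDl.
  rewrite gi -(modn_dvdm n (dvdn_mulr q (dvdnn phi))) -nE.
  rewrite modn_dvdm ?dvdn_mulr //.
  rewrite eqn_mod_dvd // => /dvdnP[l lE].
  have [z zE] := linear_mod_solvable l q_gt0 ctq.
  exists (Ordinal (ltn_pmod z q_gt0)) => //; apply/val_inj; rewrite /= hE /=.
  rewrite -[LHS](modn_small (ltn_ord y)) yn; apply/eqP; rewrite gP -nE.
  rewrite -(subnKC leBn) eqn_modDl lE mulnC eqn_mod_mul2l //.
  by rewrite modnMmr zE.
rewrite big_imset /=; last by move=> ? ? _ _; exact: h_inj.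
rewrite (eq_bigl xpredT) => [|z]; last by rewrite inE.
by apply: eq_bigr => z _; apply: F_mod; rewrite hE modn_mod.
Qed.

Lemma two_pow_surj a w :
    (1 < m)%N -> (2 = g ^ a %[mod P])%N ->
    (2 ^ e = 1 %[mod p])%N -> (2 ^ e <> 1 %[mod p ^ 2])%N ->
  (w = 1 %[mod p])%N -> exists n, (w = 2 ^ n %[mod P])%N.
Proof.
move=> m_gt1 aE two_p two_p2 w_p.
have pP : (p %| P)%N by rewrite dvdn_exp.
have ge n : (g ^ (a * n) = 2 ^ n %[mod P])%N.
  by rewrite expnM -modnXm -aE modnXm.
have p1_gt0 : (0 < p.-1)%N by rewrite -ltnS prednK ?prime_gt1.
have [|h hE] := primroot_surj p_pr m_gt0 g_ord (u := w).
  by rewrite -coprime_modl w_p coprime_modl coprime1n.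
have ord1 n : (g ^ n == 1 %[mod p])%N = (p.-1 %| n)%N.
  have := primroot_eq1 p_pr m_gt0 g_ord n (j := 1).
  by rewrite m_gt0 expn1 totient_prime // => ->.
have /dvdnP[h' h'E] : (p.-1 %| h)%N.
  by rewrite -ord1 -(modn_dvdm _ pP) -hE modn_dvdm // w_p.
have /dvdnP[a' a'E] : (p.-1 %| a * e)%N.
  by rewrite -ord1 -(modn_dvdm _ pP) ge modn_dvdm // two_p.
have ca'p : coprime a' (p ^ m.-1).
  rewrite coprimeXr // coprime_sym prime_coprime //.
  apply/negP => /dvdnP[a'' a''E]; apply: two_p2.
  rewrite -(modn_dvdm _ (dvdn_exp2l p m_gt1)) -ge modn_dvdm ?dvdn_exp2l //.
  apply/eqP; rewrite (primroot_eq1 p_pr m_gt0 g_ord) ?m_gt1 //.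
  by rewrite totient_pfactor // expn1 a'E a''E -mulnA (mulnC p) dvdn_mull.
have [|n nE] := linear_mod_solvable h' _ ca'p; first by rewrite expn_gt0 p_gt0.
exists (e * n)%N; rewrite hE -ge; apply/eqP.
rewrite (primroot_eq p_pr m_gt0 g_ord) ?m_gt0 ?leqnn // totient_pfactor //.
by rewrite mulnA a'E h'E mulnAC ![(_ * p.-1)%N]mulnC eqn_mod_mul2l // nE.
Qed.

Lemma indicator_sum_coset0 x k :
    (1 < k <= m)%N -> (p ^ k).-primitive_root x ->
    (forall c, eta (x ^+ (1 + p * c)) = eta x) ->
  \sum_(y < P | (y == g ^ B %[mod p ^ k.-1])%N) (chi y)%:R * x ^+ y = 0.
Proof.
move=> /andP[k_gt1 lekm] x_prim eta_x.
have xP : x ^+ P = 1 by apply/eqP; rewrite -(prim_order_dvd x_prim) dvdn_exp2l.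
have x_neq0 : x != 0.
  exact: unity_root_neq0 P_gt0 xP.
pose V := (g ^ B * P.-1)%N; set q := (p ^ m.-1)%N.
have pq : (p * q = P)%N by rewrite -expnS prednK.
have geom n : \sum_(c < q) x ^+ (n * (1 + p * c)) = (p ^ k.-1 %| n)%:R * x ^+ n.
  rewrite (eq_bigr (fun c : 'I_q => x ^+ n * (x ^+ (n * p)) ^+ c)); last first.
    by move=> c _; rewrite -exprM -exprD mulnDr muln1 mulnA.
  rewrite -mulr_sumr mulrC; congr (_ * _).
  have -> : (p ^ k.-1 %| n)%N = (x ^+ (n * p) == 1).
    rewrite -(prim_order_dvd x_prim) -{2}(prednK (ltnW k_gt1)) expnSr.
    by rewrite dvdn_pmul2r.
  have [->|y1] := eqVneq; last first.
    by rewrite sum_unity_root // -exprM -mulnA pq mulnC exprM xP expr1n.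
  rewrite (eq_bigr (fun=> 1)) => [|c _]; last by rewrite expr1n.
  have q_odd : odd q by rewrite oddX p_odd orbT.
  by rewrite sumr_const card_ord (natr_odd_pchar2 K2 q_odd).
have : \sum_(c < q) x ^+ (V * (1 + p * c)) * eta (x ^+ (1 + p * c)) = 0.
  under eq_bigr => c _ do rewrite eta_x.
  rewrite -mulr_suml geom.
  suff /negPf -> : ~~ (p ^ k.-1 %| V)%N by rewrite !mul0r.
  apply: contraTN (prime_gt1 p_pr) => kV; rewrite -leqNgt.
  have : (p %| g ^ B * P.-1)%N by rewrite (dvdn_trans _ kV) // dvdn_exp //; lia.
  rewrite Gauss_dvdr; last first.
    by rewrite coprime_sym -[p]expn1 (primroot_coprimeX p_pr m_gt0 g_ord).
  move=> pP; have : (p %| P)%N by rewrite dvdn_exp.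
  by rewrite -(prednK P_gt0) -addn1 dvdn_addr // dvdn1 => /eqP ->.
under eq_bigr => c _.
  rewrite mulr_sumr (eq_bigr (fun y : 'I_P =>
    (chi y)%:R * x ^+ ((V + y) * (1 + p * c)))) => [|y _].
    over.
  by rewrite mulrCA -exprM -exprD [(_ * y)%N]mulnC -mulnDl.
rewrite exchange_big /=.
under eq_bigr => y _ do rewrite -mulr_sumr geom.
move=> sum0; apply: (mulfI (expf_neq0 V x_neq0)); rewrite mulr0 -[RHS]sum0.
rewrite mulr_sumr big_mkcond; apply: eq_bigr => y _ /=.
have -> : (p ^ k.-1 %| V + y)%N = (y == g ^ B %[mod p ^ k.-1])%N.
  rewrite -(eqn_modDl V) /V -mulnSr prednK //.
  suff /eqP -> : (p ^ k.-1 %| g ^ B * P)%N by [].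
  by rewrite dvdn_mull // dvdn_exp2l //; lia.
case: ifP => _; last by rewrite mul0r mulr0.
by rewrite mul1r exprD mulrCA.
Qed.

Lemma indicator_sum_not_fixed_ramified x a k :
    (1 < k <= m)%N -> (p ^ k).-primitive_root x -> (2 = g ^ a %[mod P])%N ->
    (2 ^ e = 1 %[mod p])%N -> (2 ^ e <> 1 %[mod p ^ 2])%N ->
  eta x ^+ 2 != eta x.
Proof.
move=> km x_prim aE two_p two_p2; apply/eqP => fix_x.
have [k_gt1 lekm] := andP km; have m_gt1 := leq_trans k_gt1 lekm.
have k1_gt0 : (0 < k.-1)%N by clear -k_gt1; lia.
have k1m : (0 < k.-1 <= m)%N by clear -k_gt1 lekm; lia.
have mk_gt0 : (0 < m - k.-1)%N by clear -k_gt1 lekm; lia.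
have k2E : k.-2.+1 = k.-1 by rewrite prednK.
have mE : (m.-1 = k.-2 + (m - k.-1))%N by clear -k_gt1 lekm; lia.
have xP : x ^+ P = 1 by apply/eqP; rewrite -(prim_order_dvd x_prim) dvdn_exp2l.
have eta_x c : eta (x ^+ (1 + p * c)) = eta x.
  have [|n nE] := @two_pow_surj a (1 + p * c) m_gt1 aE two_p two_p2.
    by rewrite addnC mulnC modnMDl.
  by rewrite (eqn_mod_expr xP nE) indicator_sum_fixed.
have := indicator_sum_coset0 km x_prim eta_x.
have [t tE] : exists t, (e * t = 1 %[mod p ^ (m - k.-1)])%N.
  apply: linear_mod_solvable; rewrite ?expn_gt0 ?p_gt0 ?coprimeXr //.
  have cp : coprime p.-1 p by rewrite -{2}(prednK p_gt0) coprimenS.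
  by move: cp; rewrite p_er coprimeMl => /andP[].
set q := (p ^ (m - k.-1))%N in tE.
have pq : (p %| q)%N by rewrite dvdn_exp.
have q_gt1 : (1 < q)%N.
  by rewrite (leq_trans (prime_gt1 p_pr)) // dvdn_leq // expn_gt0 p_gt0.
have ctp : coprime t p.
  have: coprime (e * t) p.
    rewrite -coprime_modl -(modn_dvdm _ pq) tE modn_dvdm // coprime_modl.
    by rewrite coprime1n.
  by rewrite coprimeMl => /andP[].
pose F y := (chi y)%:R * x ^+ y.
rewrite (@primroot_coset_sum _ F k.-1 t) // /F; last first.
  by move=> y z yz; rewrite (chi_mod yz) (eqn_mod_expr xP yz).
rewrite -/q; set phi := totient (p ^ k.-1).
have phiE : phi = (p ^ k.-2 * (e * 2 ^ r))%N.
  by rewrite /phi totient_pfactor ?p_er 1?mulnC.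
have chiE (z : 'I_q) : chi (g ^ (B + phi * (t * z)))%N = (z < q.+1./2)%N.
  have -> : (g ^ (B + phi * (t * z)) = p ^ (m - m) * g ^ (B + phi * (t * z)))%N.
    by rewrite subnn expn0 mul1n.
  rewrite chi_primroot ?m_gt0 ?leqnn //.
  have -> : (p ^ m.-1 * 2 ^ r.-1 = p ^ k.-2 * 2 ^ r.-1 * q)%N.
    by rewrite mE expnD mulnAC.
  have -> : (phi * (t * z) = p ^ k.-2 * 2 ^ r.-1 * (e * t * z * 2))%N.
    by rewrite phiE -{1}(prednK r_gt0) expnS; clear; lia.
  have -> : (e * t * z * 2 = (e * t) %/ q * (z * 2) * q + z * 2)%N.
    rewrite {1}(divn_eq (e * t) q) tE (modn_small q_gt1).
    by move: (_ %/ q)%N; clear => w; lia.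
  rewrite divnMl ?muln_gt0 ?expn_gt0 ?p_gt0 // divnMDl ?(ltnW q_gt1) //.
  rewrite oddD mulnA oddM andbF /=.
  have := ltn_ord z; case: (ltnP (z * 2) q) => [z2 _|z2 zq].
    by rewrite divn_small //; clear -z2; lia.
  have -> : (z * 2 %/ q = 1)%N.
    rewrite -(subnK z2) addnC divnDl ?dvdnn // divnn (ltnW q_gt1).
    by rewrite divn_small //; clear -zq z2; lia.
  by clear -z2; lia.
pose u := (g ^ (phi * t))%N; pose xi := x ^+ (g ^ B * u.-1)%N.
have u_gt0 : (0 < u)%N.
  rewrite expn_gt0 lt0n; apply/orP; left.
  apply: contraTneq (primroot_coprime p_pr m_gt0 g_ord) => ->.
  by rewrite /coprime gcd0n gtn_eqF ?prime_gt1.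
have u1 : (p ^ k.-1 %| u.-1)%N.
  rewrite -[u.-1]subn1 -eqn_mod_dvd // (primroot_eq1 p_pr m_gt0 g_ord) //.
  exact: dvdn_mulr.
have xE z : x ^+ (g ^ (B + phi * (t * z)))%N = x ^+ (g ^ B)%N * xi ^+ z.
  elim: z => [|z IHz]; first by rewrite !muln0 addn0 mulr1.
  rewrite exprSr mulrA -IHz mulnSr mulnDr addnA [(g ^ (_ + _ * t))%N]expnD -/u.
  rewrite -{1}(prednK u_gt0) mulnS exprD; congr (_ * _).
  apply/eqP; rewrite (eq_prim_root_expr x_prim).
  rewrite -(prednK (ltnW k_gt1)) expnSr; case/dvdnP: u1 => w ->.
  rewrite !mulnA ![(_ * p ^ k.-1)%N]mulnC eqn_mod_mul2l ?expn_gt0 ?p_gt0 //.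
  have gz : (g ^ (B + phi * t * z) = g ^ B %[mod p])%N.
    have pk : (p %| p ^ k.-1)%N by rewrite dvdn_exp.
    rewrite -(modn_dvdm _ pk) -[RHS](modn_dvdm _ pk).
    congr (_ %% _)%N; apply/eqP.
    rewrite (primroot_eq p_pr m_gt0 g_ord) //.
    by rewrite -{2}[B]addn0 eqn_modDl mod0n -mulnA modnMr.
  by rewrite ![(_ * w)%N]mulnC -modnMmr gz modnMmr.
under eq_bigr => z _ do rewrite chiE xE.
move=> sum0.
have xi_p : xi ^+ p = 1.
  apply/eqP; rewrite -exprM -(prim_order_dvd x_prim).
  by rewrite -(prednK (ltnW k_gt1)) expnSr dvdn_mul // dvdn_mull.
have xi_1 : xi != 1.
  rewrite -(prim_order_dvd x_prim) Gauss_dvdr; last first.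
    by rewrite coprime_sym (primroot_coprimeX p_pr m_gt0 g_ord).
  rewrite -[u.-1]subn1 -eqn_mod_dvd //.
  rewrite (primroot_eq1 p_pr m_gt0 g_ord) ?(ltnW k_gt1) //.
  have -> : totient (p ^ k) = (phi * p)%N.
    rewrite phiE totient_pfactor 1?ltnW // p_er mulnC.
    by rewrite [(_ * p)%N]mulnAC -expnSr k2E.
  rewrite dvdn_pmul2l ?totient_gt0 ?expn_gt0 ?p_gt0 //.
  by rewrite -prime_coprime // coprime_sym.
have sum_xi : \sum_(z < q.+1./2) xi ^+ z = 0.
  apply: (mulfI (expf_neq0 (g ^ B) (unity_root_neq0 P_gt0 xP))).
  rewrite mulr0 -[RHS]sum0 mulr_sumr.
  rewrite (big_ord_widen q (fun z => x ^+ (g ^ B)%N * xi ^+ z)); last first.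
    by clear -q_gt1; lia.
  rewrite big_mkcond; apply: eq_bigr => z _.
  by case: ifP; rewrite ?mul1r ?mul0r.
have xi_half : xi ^+ q.+1./2 = 1.
  by apply/eqP; rewrite -subr_eq0 subrX1 sum_xi mulr0.
case/eqP: xi_1; rewrite -(expr1 xi) -[RHS](expr1n _ 2) -xi_half -exprM.
apply: (eqn_mod_expr xi_p).
have -> : (q.+1./2 * 2 = 1 + q)%N.
  have q_odd : odd q by rewrite oddX p_odd orbT.
  by clear -q_odd; lia.
by rewrite -modnDmr (eqP pq) addn0.
Qed.

Lemma two_exp_index a : (2 = g ^ a %[mod P])%N ->
  (2 ^ e == 1 %[mod p])%N = (2 ^ r %| a)%N.
Proof.
move=> aE; have e_gt0 : (0 < e)%N.
  have := prime_gt1 p_pr; rewrite -(prednK p_gt0) p_er.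
  by case: e => //; rewrite mul0n.
have pP : (p %| P)%N by rewrite dvdn_exp.
have := primroot_eq1 p_pr m_gt0 g_ord (a * e) (j := 1).
rewrite m_gt0 expn1 totient_prime // p_er [(e * _)%N]mulnC.
rewrite dvdn_pmul2r // => <- //.
rewrite -(modn_dvdm (2 ^ e) pP) -(modn_dvdm (g ^ _) pP).
by rewrite expnM -modnXm aE modnXm.
Qed.

End HalfSum.

Lemma eqn_Zp_nat s x y :
  (1 < s)%N -> (x%:R == y%:R :> 'Z_s) = (x == y %[mod s])%N.
Proof. by move=> s_gt1; rewrite -val_eqE /= !val_Zp_nat. Qed.

Lemma Zp_intr_modz s N (g : int) : (1 < s)%N -> (s %| N)%N -> (0 < N)%N ->
  g%:~R = (`|(g %% N)%Z|%N)%:R :> 'Z_s.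
Proof.
move=> s_gt1 /dvdnP[k kE] N_gt0; rewrite {1}(divz_eq g N) intrD intrM.
have -> : (N : int)%:~R = 0 :> 'Z_s.
  by rewrite kE -pmulrn natrM pchar_Zp // mulr0.
by rewrite mulr0 add0r pmulrn gez0_abs ?modz_ge0 // eqz_nat -lt0n.
Qed.

Lemma exprz_modz (R : unitRingType) (u : R) k (b : int) :
  u \is a GRing.unit -> (0 < k)%N -> u ^+ k = 1 -> u ^ b = u ^+ `|(b %% k)%Z|.
Proof.
move=> u_unit k_gt0 uk; rewrite {1}(divz_eq b k) exprzDr //.
rewrite [(_ * k%:Z)%R]mulrC -exprz_exp -exprnP uk exp1rz mul1r.
by rewrite exprnP gez0_abs // modz_ge0 // eqz_nat -lt0n.
Qed.

Lemma mem_bigcup_nat (T : finType) (F : nat -> {set T}) i j k x :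
  (i <= j < k)%N -> x \in F j -> x \in \bigcup_(i <= l < k) F l.
Proof.
move=> ijk xF; rewrite (bigD1_seq j) ?iota_uniq ?mem_index_iota //=.
by rewrite inE xF.
Qed.

Lemma mem_dilate N a s (A : {set 'Z_s}) u x :
    (1 < s)%N -> (1 < N)%N -> (N = a * s)%N -> u%:R \in A ->
  (x = a * u %[mod N])%N -> x%:R \in dilate N a A.
Proof.
move=> s_gt1 N_gt1 NE uA xE; apply/imsetP; exists u%:R => //.
apply/eqP; rewrite eqn_Zp_nat // xE val_Zp_nat // NE muln_modr.
by rewrite modn_mod.
Qed.

Lemma mem_Dclass p e j s N k n (g b : int) :
    (1 < s)%N -> (0 < N)%N -> (s %| N)%N -> (0 < k)%N ->
    totient s = (dj p e j * e)%N -> (totient s %| k)%N ->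
    coprime `|(g %% N)%Z| s ->
  ((`|(g %% N)%Z| ^ (`|(b %% k)%Z| + n))%:R : 'Z_s)
    \in Dclass p e g j s ((n %% dj p e j)%:Z + b).
Proof.
move=> s_gt1 N_gt0 sN k_gt0 tot_s tot_k cgs; set d := dj p e j in tot_s *.
have := tot_s; have : (0 < totient s)%N by rewrite totient_gt0 ltnW.
case: e @d tot_s => [|e] d tot_s; first by rewrite tot_s muln0.
set u : 'Z_s := g%:~R.
have uE : u = (`|(g %% N)%Z|%N)%:R by exact: Zp_intr_modz.
have u_unit : u \is a GRing.unit by rewrite uE unitZpE // coprime_sym.
have ut : u ^+ totient s = 1.
  apply/eqP; rewrite uE -natrX -[1]/(1%:R) eqn_Zp_nat //.
  by rewrite Euler_exp_totient.
move=> tot_gt0 _; apply/imsetP.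
exists (Ordinal (ltn_pmod (n %/ d) (ltn0Sn e))) => //.
rewrite -/u addrAC -PoszD exprzDr // natrX -uE mulrC.
have uk : u ^+ k = 1.
  by case/dvdnP: tot_k => i ->; rewrite mulnC exprM ut expr1n.
rewrite (exprz_modz b u_unit k_gt0 uk) exprD; congr (_ * _).
rewrite /= -[u ^ _]/(u ^+ _) {1}(divn_eq n d) {1}(divn_eq (n %/ d) e.+1) mulnDl.
rewrite -addnA -mulnA [(e.+1 * d)%N]mulnC -tot_s [(_ * totient s)%N]mulnC.
by rewrite exprD exprM ut expr1n mul1r addnC [(_ * d)%N]mulnC.
Qed.

Section Sequence.

Variables (p m e r : nat) (b g : int) (s : nat -> 'F_2).
Hypotheses (p_pr : prime p) (p_odd : odd p) (m_gt0 : (0 < m)%N).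
Hypotheses (r_gt0 : (0 < r)%N) (p_er : (p.-1 = e * 2 ^ r)%N).
Hypothesis g_odd : ~~ (2 %| g)%Z.
Hypothesis g_prim : (totient (p ^ m)).-primitive_root (g%:~R : 'Z_(p ^ m)).
Hypothesis s_C1 :
  forall i : nat, (i%:R : 'Z_(2 * p ^ m)) \in C1 p m e g b -> s i = 1.
Hypothesis s_C0 :
  forall i : nat, (i%:R : 'Z_(2 * p ^ m)) \in C0 p m e g b -> s i = 0.

Let P := (p ^ m)%N.
Let N := (2 * p ^ m)%N.
Let g0 := `|(g %% N)%Z|%N.
Let b0 := `|(b %% totient (p ^ m))%Z|%N.
Let delta j := (p ^ j.-1 * 2 ^ r.-1)%N.

Let p_gt0 : (0 < p)%N := prime_gt0 p_pr.
Let P_gt0 : (0 < P)%N.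
Proof. by rewrite expn_gt0 p_gt0. Qed.
Let P_gt1 : (1 < P)%N.
Proof. by rewrite -{1}(exp1n m) ltn_exp2r ?prime_gt1. Qed.
Let N_gt0 : (0 < N)%N.
Proof. by rewrite muln_gt0. Qed.
Let N_gt1 : (1 < N)%N.
Proof. by rewrite (leq_trans P_gt1) // leq_pmull. Qed.
Let P_odd : odd P.
Proof. by rewrite oddX p_odd orbT. Qed.
Let e_gt0 : (0 < e)%N.
Proof.
have := prime_gt1 p_pr; rewrite -(prednK p_gt0) p_er.
by case: e => //; rewrite mul0n.
Qed.

Lemma residue_odd : odd g0.
Proof.
have : (2 %| g0%:Z)%Z = (2 %| g)%Z.
  rewrite gez0_abs ?modz_ge0 -?lt0n // [in RHS](divz_eq g N) [RHS]rpredDl //.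
  by rewrite dvdz_mull // dvdzE /= dvdn_mulr.
by move: g_odd => /[swap] <-; rewrite dvdzE /= dvdn2 negbK.
Qed.

Lemma residue_primroot n : (g0 ^ n == 1 %[mod P])%N = (totient P %| n)%N.
Proof.
rewrite (prim_order_dvd g_prim) (@Zp_intr_modz _ N) ?dvdn_mull // -natrX.
by rewrite -[1]/(1%:R) eqn_Zp_nat.
Qed.

Lemma dj_half_period j : (0 < j)%N -> dj p e j = (delta j * 2)%N.
Proof.
move=> j_gt0; rewrite /dj totient_pfactor // p_er -mulnA mulKn // /delta.
by rewrite -{1}(prednK r_gt0) expnSr mulnC mulnA.
Qed.

Lemma deltaj_half j : (0 < j)%N -> deltaj p e j = delta j.
Proof. by move=> j_gt0; rewrite /deltaj dj_half_period // mulnK. Qed.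

Lemma totient_dj j : (0 < j)%N -> totient (p ^ j) = (dj p e j * e)%N.
Proof.
by move=> j_gt0; rewrite /dj divnK // totient_pfactor // p_er -mulnA dvdn_mulr.
Qed.

Lemma totient_dvd j : (0 < j <= m)%N -> (totient (p ^ j) %| totient (p ^ m))%N.
Proof.
case/andP=> j_gt0 lejm; rewrite !totient_pfactor // dvdn_mul // dvdn_exp2l //.
by lia.
Qed.

Lemma totient2 j : totient (2 * p ^ j) = totient (p ^ j).
Proof.
by rewrite totient_coprime ?mul1n // coprimeXr // coprime2n.
Qed.

Lemma mod_dj_half j n : (0 < j)%N ->
  (n %% dj p e j < deltaj p e j)%N = ~~ odd (n %/ delta j).
Proof.
move=> j_gt0; rewrite deltaj_half // dj_half_period //.
have d_gt0 : (0 < delta j)%N by rewrite muln_gt0 !expn_gt0 p_gt0.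
rewrite {2}(divn_eq n (delta j * 2)) [(delta j * 2)%N]mulnC mulnA divnMDl //.
rewrite oddD oddM andbF /= mulnC -/(delta j).
have := ltn_pmod n (_ : 0 < 2 * delta j)%N; rewrite muln_gt0 d_gt0 => /(_ isT).
rewrite [(delta j * 2)%N]mulnC; set i := (n %% _)%N => lti.
case: (ltnP i (delta j)) => [ltid|leid]; first by rewrite divn_small.
rewrite -(subnK leid) addnC divnDl ?dvdnn // divnn d_gt0 divn_small //.
by rewrite ltn_subLR // addnn -mul2n.
Qed.

Lemma residue_coprime j : coprime g0 (p ^ j).
Proof.
have := primroot_coprimeX p_pr m_gt0 residue_primroot 1 j.
by rewrite expn1.
Qed.

Lemma pow_sub_mul j : (0 < j <= m)%N -> (p ^ (m - j) * p ^ j = p ^ m)%N.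
Proof. by case/andP=> _ lejm; rewrite -expnD subnK. Qed.

Lemma mem_oddD j n x : (0 < j <= m)%N ->
    (x = p ^ (m - j) * g0 ^ (b0 + n) %[mod N])%N ->
  x%:R \in Defs.oddD p m e g j ((n %% dj p e j)%:Z + b).
Proof.
move=> jm xE; have /andP[j_gt0 lejm] := jm.
have pj_gt0 : (0 < p ^ j)%N by rewrite expn_gt0 p_gt0.
apply: (mem_dilate _ N_gt1 _ _ xE); rewrite ?leq_pmulr //.
- by rewrite mulnCA pow_sub_mul.
apply: mem_Dclass; rewrite // ?totient2.
- by rewrite leq_pmulr.
- by rewrite dvdn_mul // dvdn_exp2l.
- by rewrite totient_gt0.
- exact: totient_dj.
- exact: totient_dvd.
- by rewrite coprimeMr residue_coprime coprimen2 residue_odd.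
Qed.

Lemma mem_evenD j n x : (0 < j <= m)%N ->
    (x = 2 * (p ^ (m - j) * g0 ^ (b0 + n)) %[mod N])%N ->
  x%:R \in evenD p m e g j ((n %% dj p e j)%:Z + b).
Proof.
move=> jm; have /andP[j_gt0 lejm] := jm; rewrite mulnA => xE.
have pj_gt1 : (1 < p ^ j)%N by rewrite -{1}(exp1n j) ltn_exp2r ?prime_gt1.
apply: (mem_dilate _ N_gt1 _ _ xE); rewrite // -?mulnA ?pow_sub_mul //.
apply: mem_Dclass; rewrite //.
- by rewrite dvdn_mull // dvdn_exp2l.
- by rewrite totient_gt0.
- exact: totient_dj.
- exact: totient_dvd.
- exact: residue_coprime.
Qed.

Lemma seq_odd j n x : (0 < j <= m)%N ->
    (x = p ^ (m - j) * g0 ^ (b0 + n) %[mod N])%N ->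
  s x = (~~ odd (n %/ delta j))%:R.
Proof.
move=> jm /(mem_oddD jm) xD; have /andP[j_gt0 lejm] := jm.
have ltnd : (n %% dj p e j < dj p e j)%N.
  by rewrite ltn_mod dj_half_period // !muln_gt0 !expn_gt0 p_gt0.
rewrite -mod_dj_half //; case: ltnP => hn; [apply: s_C1 | apply: s_C0];
  rewrite inE; apply/orP; left; apply: (@mem_bigcup_nat _ _ 1 j);
  rewrite ?j_gt0 ?ltnS // inE; apply/orP; right.
all: apply: (@mem_bigcup_nat _ (fun i => Defs.oddD p m e g j (i%:Z + b)) _
  (n %% dj p e j)) => //.
by rewrite hn.
Qed.

Lemma seq_even j n x : (0 < j <= m)%N ->
    (x = 2 * (p ^ (m - j) * g0 ^ (b0 + n)) %[mod N])%N ->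
  s x = (odd (n %/ delta j))%:R.
Proof.
move=> jm /(mem_evenD jm) xD; have /andP[j_gt0 lejm] := jm.
have ltnd : (n %% dj p e j < dj p e j)%N.
  by rewrite ltn_mod dj_half_period // !muln_gt0 !expn_gt0 p_gt0.
rewrite -[odd _]negbK -mod_dj_half // -leqNgt.
case: leqP => hn; [apply: s_C1 | apply: s_C0];
  rewrite inE; apply/orP; left; apply: (@mem_bigcup_nat _ _ 1 j);
  rewrite ?j_gt0 ?ltnS // inE; apply/orP; left.
all: apply: (@mem_bigcup_nat _ (fun i => evenD p m e g j (i%:Z + b)) _
  (n %% dj p e j)) => //.
by rewrite hn.
Qed.

Lemma seq0 x : (x = 0 %[mod N])%N -> s x = 1.
Proof.
move=> xE; apply: s_C1; rewrite !inE; apply/orP; right.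
by rewrite -[0]/(0%:R) eqn_Zp_nat // xE.
Qed.

Lemma seqP x : (x = P %[mod N])%N -> s x = 0.
Proof.
move=> xE; apply: s_C0; rewrite !inE; apply/orP; right.
by rewrite eqn_Zp_nat // xE.
Qed.

Lemma eqn_modN x y :
  (x == y %[mod N])%N = (odd x == odd y) && (x == y %[mod P])%N.
Proof.
rewrite /N chinese_remainder ?coprime2n // !modn2; congr (_ && _).
by case: (odd x); case: (odd y).
Qed.

Lemma seq_mod x y : (x = y %[mod N])%N -> s x = s y.
Proof.
move=> xy; have [x_odd|x_even] := boolP (odd x).
  have [Px|Px] := boolP (P %| x)%N.
    have xE : (x = P %[mod N])%N.
      by apply/eqP; rewrite eqn_modN x_odd P_odd modnn; exact: Px.
    by rewrite !seqP // -xy.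
  have [j [n jm xE]] := primroot_residue p_pr m_gt0 residue_primroot b0 Px.
  have xE' : (x = p ^ (m - j) * g0 ^ (b0 + n) %[mod N])%N.
    apply/eqP; rewrite eqn_modN xE eqxx andbT x_odd oddM !oddX p_odd.
    by rewrite residue_odd !orbT.
  by rewrite (seq_odd jm xE') (seq_odd jm (etrans (esym xy) xE')).
have xE : (x = 2 * x./2)%N by rewrite mul2n even_halfK.
have [Px|Px] := boolP (P %| x./2)%N.
  have x0 : (x = 0 %[mod N])%N.
    by rewrite xE; apply/eqP; rewrite mod0n -/(dvdn _ _) dvdn_pmul2l.
  by rewrite !seq0 // -xy.
have [j [n jm xE']] := primroot_residue p_pr m_gt0 residue_primroot b0 Px.
have xE2 : (x = 2 * (p ^ (m - j) * g0 ^ (b0 + n)) %[mod N])%N.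
  by rewrite xE; apply/eqP; rewrite eqn_mod_mul2l // xE'.
by rewrite (seq_even jm xE2) (seq_even jm (etrans (esym xy) xE2)).
Qed.

(* [P.+1 * y + P] is odd and congruent to [y] modulo [P]. *)
Definition odd_part y := s (P.+1 * y + P)%N == 1.

Lemma odd_part_mod x y : (x = y %[mod P])%N -> odd_part x = odd_part y.
Proof.
move=> xy; congr (_ == _); apply/seq_mod/eqP; rewrite eqn_modDr eqn_modN.
rewrite !oddM /= P_odd /= -modnMmr xy modnMmr eqxx //.
Qed.

Lemma odd_part0 : odd_part 0%N = false.
Proof. by rewrite /odd_part muln0 seqP. Qed.

Lemma odd_part_primroot j n : (0 < j <= m)%N ->
  odd_part (p ^ (m - j) * g0 ^ (b0 + n))%N = ~~ odd (n %/ delta j).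
Proof.
move=> jm; rewrite /odd_part (@seq_odd j n) //; first by case: (odd _).
apply/eqP; rewrite eqn_modN oddD !oddM !oddX /= P_odd p_odd residue_odd.
rewrite !orbT /=.
have modP Y : (P.+1 * Y + P = Y %[mod P])%N.
  by rewrite modnDr mulSn addnC mulnC modnMDl.
by rewrite modP.
Qed.

Lemma seq_double y : s (2 * y)%N = 1 + (odd_part y)%:R.
Proof.
have [Py|Py] := boolP (P %| y)%N.
  rewrite (@odd_part_mod y 0) ?odd_part0 ?addr0.
    by apply: seq0; apply/eqP; rewrite mod0n -/(dvdn _ _) dvdn_pmul2l.
  by rewrite mod0n; exact/eqP.
have [j [n jm yE]] := primroot_residue p_pr m_gt0 residue_primroot b0 Py.
rewrite (odd_part_mod yE) odd_part_primroot // (@seq_even j n) //.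
  by case: (odd _); apply/val_inj.
by apply/eqP; rewrite eqn_mod_mul2l // yE.
Qed.

End Sequence.

Section RootsOfSequence.

Variables (P : nat) (s : nat -> 'F_2) (chi : nat -> bool).
Hypothesis P_odd : odd P.
Hypothesis s_mod : forall x y, (x = y %[mod 2 * P])%N -> s x = s y.
Hypothesis chiE : forall y, s (P.+1 * y + P)%N = (chi y)%:R.
Hypothesis s_double : forall y, s (2 * y)%N = 1 + (chi y)%:R.

Variables (K : fieldType) (iota : {rmorphism 'F_2 -> K}).

Local Notation eta := (@indicator_sum K P chi).

Let P_gt0 : (0 < P)%N.
Proof. by case: P P_odd. Qed.

Let pchar2 : 2 \in [pchar K].
Proof. by rewrite (rmorph_pchar iota) // pchar_Fp. Qed.

Lemma horner_window x : x ^+ P = 1 ->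
  (map_poly iota (window s (2 * P) 0)).[x] =
    \sum_(y < P) x ^+ y + (eta (x ^+ 2) + eta x).
Proof.
move=> xP; pose F i := iota (s i) * x ^+ i.
have F_mod i j : (i = j %[mod 2 * P])%N -> F i = F j.
  move=> ij; rewrite /F (s_mod ij); congr (_ * _).
  apply: eqn_mod_expr xP _.
  by rewrite -(modn_dvdm i (dvdn_mull 2 (dvdnn P))) ij modn_dvdm // dvdn_mull.
have -> : (map_poly iota (window s (2 * P) 0)).[x] = \sum_(i < 2 * P) F i.
  rewrite (@horner_coef_wide _ (2 * P)) ?size_map_poly ?size_poly //.
  by apply: eq_bigr => i _; rewrite coef_map coef_poly ltn_ord addn0.
have -> : \sum_(i < 2 * P) F i =
    \sum_(y < P) F (P.+1 * y)%N + \sum_(y < P) F (P.+1 * y + P)%N.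
  rewrite -(big_mkord predT) [in LHS]mul2n -addnn big_mkord big_split_ord /=.
  rewrite -[LHS]big_split -[RHS]big_split /=; apply: eq_bigr => y _.
  have PyE : (P.+1 * y = y./2 * (2 * P) + (odd y * P + y))%N.
    by have := odd_double_half y; lia.
  case: (odd y) PyE => PyE; rewrite PyE; last first.
    by congr (_ + _); apply: F_mod; rewrite -?addnA modnMDl // addnC.
  rewrite addrC; congr (_ + _); apply: F_mod; rewrite -?addnA modnMDl ?mul1n //.
  by rewrite add0n addnCA addnn -mul2n modnDr.
have -> : \sum_(y < P) F (P.+1 * y)%N = \sum_(y < P) F (2 * y)%N.
  rewrite -(@sum_coprime_mul _ (fun y => F (P.+1 * y)%N) P 2) ?coprime2n //.
    apply: eq_bigr => y _; apply: F_mod.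
    by rewrite mulSn addnC mulnCA mulnA [(2 * P * y)%N]mulnC modnMDl.
  move=> y z yz; apply: F_mod; apply/eqP.
  rewrite chinese_remainder ?coprime2n // !modn2 !oddM /= P_odd eqxx /=.
  by rewrite -modnMmr yz modnMmr.
have -> : \sum_(y < P) x ^+ y = \sum_(y < P) x ^+ (2 * y)%N.
  rewrite (@sum_coprime_mul _ (fun y => x ^+ y) P 2) ?coprime2n //.
  by move=> y z; exact: eqn_mod_expr.
rewrite addrA /indicator_sum -[X in _ = X + _]big_split /=.
congr (_ + _); apply: eq_bigr => y _.
  by rewrite /F s_double rmorphD rmorph1 rmorph_nat mulrDl mul1r exprM.
rewrite /F chiE rmorph_nat; congr (_ * _); apply: eqn_mod_expr xP _.
by rewrite modnDr mulSn addnC mulnC modnMDl.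
Qed.

Lemma root_window x : x ^+ P = 1 ->
  root (map_poly iota (window s (2 * P) 0)) x =
    (x != 1) && (eta (x ^+ 2) == eta x).
Proof.
move=> xP; rewrite rootE horner_window //; have [->|x1] := eqVneq x 1.
  rewrite expr1n addrr_pchar2 // addr0.
  under eq_bigr => y _ do rewrite expr1n.
  by rewrite sumr_const card_ord natr_odd_pchar2 // oner_eq0.
by rewrite sum_unity_root // add0r addr_eq0 (oppr_pchar2 pchar2).
Qed.

End RootsOfSequence.

Lemma Xn_sub_1_sqr P : 'X^(2 * P) - 1 = ('X^P - 1) ^+ 2 :> {poly 'F_2}.
Proof.
have pchar2 : 2 \in [pchar {poly 'F_2}] by rewrite pchar_poly pchar_Fp.
rewrite exprDn_pchar ?pnatE // sqrrN expr1n -exprM mulnC.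
by rewrite (oppr_pchar2 pchar2).
Qed.

Lemma separable_Xn_sub_1_odd (F : fieldType) P :
  2 \in [pchar F] -> odd P -> separable_poly ('X^P - 1 : {poly F}).
Proof.
move=> F2 P_odd; apply: separable_Xn_sub_1.
by rewrite natr_odd_pchar2 // oner_eq0.
Qed.

Section GcdDegree.

Variables (p m : nat) (S : {poly 'F_2}).
Variables (K : closedFieldType) (iota : {rmorphism 'F_2 -> K}).
Hypotheses (p_gt0 : (0 < p)%N) (p_odd : odd p) (m_gt0 : (0 < m)%N).

Let P := (p ^ m)%N.
Let A : {poly 'F_2} := 'X^(2 * P) - 1.

Let P_odd : odd P.
Proof. by rewrite oddX p_odd orbT. Qed.

Let pchar2 : 2 \in [pchar K].
Proof. by rewrite (rmorph_pchar iota) // pchar_Fp. Qed.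

Let map_Xn_sub_1 n : map_poly iota ('X^n - 1) = 'X^n - 1.
Proof. by rewrite rmorphB rmorph1 /= map_polyXn. Qed.

Lemma size_gcdp_noroot :
    (forall x, x ^+ P = 1 -> ~~ root (map_poly iota S) x) ->
  size (gcdp A S) = 1%N.
Proof.
move=> noroot; apply/eqP; rewrite -/(coprimep A S) /A Xn_sub_1_sqr.
rewrite coprimep_expl //.
rewrite -(coprimep_map iota) map_Xn_sub_1.
apply/Pdiv.ClosedField.coprimepP => x.
by rewrite rootE !hornerE subr_eq0 => /eqP /noroot.
Qed.

Lemma size_gcdp_root_order :
    (forall x, x ^+ P = 1 ->
       root (map_poly iota S) x = (x != 1) && (x ^+ p == 1)) ->
  (p <= size (gcdp A S) <= (2 * p.-1).+1)%N.
Proof.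
move=> rootS; set Phi : {poly 'F_2} := \sum_(i < p) 'X^i.
have PhiE : 'X^p - 1 = ('X - 1) * Phi by rewrite subrX1.
have szPhi : size Phi = p.
  have : size ('X^p - 1 : {poly 'F_2}) = p.+1 by rewrite size_Xn_sub_1.
  have Phi_nz : Phi != 0.
    apply/eqP => Phi0; have := size_Xn_sub_1 'F_2 p_gt0.
    by rewrite PhiE Phi0 mulr0 size_poly0.
  rewrite PhiE -polyC1 size_mul ?polyXsubC_eq0 // size_XsubC => -[].
  by [].
pose W : {poly 'F_2} := ('X - 1) * \sum_(i < p ^ m.-1) ('X^p) ^+ i.
have XPE : 'X^P - 1 = Phi * W.
  rewrite /P -(prednK m_gt0) expnS exprM subrX1 PhiE.
  by rewrite /W [(_ - 1) * Phi]mulrC mulrA.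
have sepP : separable_poly (map_poly iota Phi * map_poly iota W).
  by rewrite -rmorphM -XPE /= map_Xn_sub_1 separable_Xn_sub_1_odd.
move: sepP; rewrite separable_mul => /and3P[sepPhi _ copPhiW].
have rootXn (q : {poly 'F_2}) n x :
    q %| 'X^n - 1 -> root (map_poly iota q) x -> x ^+ n = 1.
  rewrite -(dvdp_map iota) map_Xn_sub_1 => /dvdpP[q' qE] rq.
  have : root ('X^n - 1) x by rewrite qE rootM rq orbT.
  by rewrite rootE !hornerE subr_eq0 => /eqP.
have rootPhi x : x ^+ p = 1 -> x != 1 -> root (map_poly iota Phi) x.
  move=> xp x1; have : root ('X^p - 1 : {poly K}) x.
    by rewrite rootE !hornerE xp subrr.
  rewrite -map_Xn_sub_1 PhiE rmorphM rootM rmorphB rmorph1 /= map_polyX.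
  by rewrite rootE !hornerE subr_eq0 (negPf x1).
have Phi_p : Phi %| 'X^p - 1 by rewrite PhiE dvdp_mull.
have copWS : coprimep W S.
  rewrite -(coprimep_map iota); apply/Pdiv.ClosedField.coprimepP => x rW.
  have xP : x ^+ P = 1 by apply: (rootXn W); rewrite // XPE dvdp_mull.
  rewrite -rootE rootS //; apply/andP => -[x1 /eqP xp].
  by have /negP := coprimep_root copPhiW (rootPhi x xp x1); apply.
have PhiS : Phi %| S.
  rewrite -(dvdp_map iota).
  have [rs PhiRs] := closed_field_poly_normal (map_poly iota Phi).
  have lc_nz : lead_coef (map_poly iota Phi) != 0.
    by rewrite lead_coef_eq0 -size_poly_eq0 size_map_poly szPhi -lt0n.
  rewrite PhiRs dvdpZl //; apply: uniq_roots_dvdp; last first.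
    rewrite uniq_rootsE -separable_prod_XsubC.
    by move: sepPhi; rewrite PhiRs (eqp_separable (eqp_scale _ lc_nz)).
  apply/allP => x x_rs; have rPhi : root (map_poly iota Phi) x.
    by rewrite PhiRs rootZ // root_prod_XsubC.
  have xp : x ^+ p = 1 by exact: rootXn Phi_p rPhi.
  rewrite rootS; last by rewrite /P -(prednK m_gt0) expnS exprM xp expr1n.
  rewrite xp eqxx andbT; apply: contraTneq rPhi => ->.
  rewrite rootE raddf_sum horner_sum (eq_bigr (fun=> 1)) => [|i _]; last first.
    by rewrite /= map_polyXn hornerXn expr1n.
  by rewrite sumr_const card_ord natr_odd_pchar2 // oner_eq0.
have AE : A = Phi ^+ 2 * W ^+ 2 by rewrite /A Xn_sub_1_sqr XPE exprMn.
have Phi2_nz : Phi ^+ 2 != 0 by rewrite expf_neq0 // -size_poly_eq0 szPhi -lt0n.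
apply/andP; split.
  rewrite -[X in (X <= _)%N]szPhi dvdp_leq ?dvdp_gcd ?PhiS ?andbT //.
    rewrite gcdp_eq0 negb_and; apply/orP; left.
    by rewrite -size_poly_eq0 size_Xn_sub_1 // muln_gt0 expn_gt0 p_gt0.
  by rewrite AE expr2 -mulrA dvdp_mulr.
have -> : (2 * p.-1).+1 = size (Phi ^+ 2).
  by rewrite -[RHS]prednK ?lt0n ?size_poly_eq0 // size_exp szPhi mulnC.
apply: dvdp_leq => //; rewrite -(@Gauss_dvdpl _ _ (W ^+ 2)) -?AE ?dvdp_gcdl //.
apply: coprimep_expr; rewrite coprimep_sym.
exact: coprimep_dvdl (dvdp_gcdr A S) copWS.
Qed.

End GcdDegree.

Theorem theorem2 (p m e f r : nat) (b g : int) (s : nat -> 'F_2)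
  (p_prime : prime p) (p_odd : odd p) (m_ge1 : (1 <= m)%N)
  (p_ef : (p - 1)%N = (e * f)%N) (f_pow2 : f = (2 ^ r)%N) (r_ge1 : (1 <= r)%N)
  (g_odd : ~~ (2 %| g)%Z)
  (g_prim : (totient (p ^ m)).-primitive_root (g%:~R : 'Z_(p ^ m)))
  (s_C1 : forall i : nat, (i%:R : 'Z_(2 * p ^ m)) \in C1 p m e g b -> s i = 1)
  (s_C0 : forall i : nat, (i%:R : 'Z_(2 * p ^ m)) \in C0 p m e g b -> s i = 0) :
  ((2 ^ e <> 1 %[mod p])%N -> is_linear_complexity s (2 * p ^ m)) /\
  ((2 ^ e = 1 %[mod p])%N -> (2 ^ e <> 1 %[mod p ^ 2])%N ->
   exists2 L : nat, is_linear_complexity s L &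
     (2 * p ^ m - 2 * (p - 1) <= L <= 2 * p ^ m - (p - 1))%N).
Proof.
have p_er : (p.-1 = e * 2 ^ r)%N by rewrite -subn1 p_ef f_pow2.
have p_gt0 := prime_gt0 p_prime.
have g0_ord := residue_primroot p_prime m_ge1 g_prim.
have s_mod := seq_mod p_prime p_odd m_ge1 r_ge1 p_er g_odd g_prim
  s_C1 s_C0.
have chi_mod := odd_part_mod p_prime p_odd m_ge1 r_ge1 p_er g_odd g_prim
  s_C1 s_C0.
have chi0 : odd_part p m s 0%N = false by exact: odd_part0 p_prime m_ge1 s_C0.
have chi_pr := odd_part_primroot p_prime p_odd m_ge1 r_ge1 p_er g_odd g_prim
  s_C1 s_C0.
have s_dbl := seq_double p_prime p_odd m_ge1 r_ge1 p_er g_odd g_prim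
  s_C1 s_C0.
have P_odd : odd (p ^ m) by rewrite oddX p_odd orbT.
have N_gt0 : (0 < 2 * p ^ m)%N by rewrite muln_gt0 expn_gt0 p_gt0.
have chiE y : s ((p ^ m).+1 * y + p ^ m)%N = (odd_part p m s y)%:R.
  by rewrite /odd_part; case: (s _) => -[|[|[]]] //= ?; apply/val_inj.
have [K [iota _]] := countable_algebraic_closure 'F_2.
have K2 : 2 \in [pchar K] by rewrite (rmorph_pchar iota) // pchar_Fp.
pose S := window s (2 * p ^ m) 0.
pose h (x : K) := indicator_sum (p ^ m) (odd_part p m s) x.
have rootE x : x ^+ (p ^ m) = 1 ->
    root (map_poly iota S) x = (x != 1) && (h x ^+ 2 == h x).
  move=> xP; rewrite /h indicator_sum_sqr //.
  exact: (root_window P_odd s_mod chiE s_dbl).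
have [a aE] : exists a, (2 = `|(g %% (2 * p ^ m)%N)%Z| ^ a %[mod p ^ m])%N.
  by apply: (primroot_surj p_prime m_ge1 g0_ord); rewrite coprime2n.
have two_a := two_exp_index p_prime m_ge1 p_er g0_ord aE.
have S_nz : S != 0.
  apply/eqP => /(congr1 (fun q : {poly 'F_2} => q`_0)) /eqP.
  rewrite coef_poly N_gt0 coef0 (s_dbl 0%N : s 0%N = _).
  by rewrite chi0.
have := linear_complexity_gcdp N_gt0 _ S_nz.
set G := gcdp _ _ => LC.
have {}LC : is_linear_complexity s (2 * p ^ m - (size G).-1)%N.
  by apply: LC => i; apply: s_mod; rewrite modnDr.
split=> [two_p | two_p two_p2].
- have szG : size G = 1%N.
    apply: (size_gcdp_noroot (iota := iota)) => x xP.
    rewrite rootE //; apply/negP => /andP[x1]; apply/negP.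
    apply: (indicator_sum_not_fixed p_prime p_odd m_ge1 r_ge1 p_er g0_ord
      chi_mod chi0 chi_pr K2 xP x1 aE).
    by rewrite -two_a; apply/eqP.
  by move: LC; rewrite szG subn0.
exists (2 * p ^ m - (size G).-1)%N => //.
have : (p <= size G <= (2 * p.-1).+1)%N; last by rewrite subn1; clear; lia.
apply: (size_gcdp_root_order (iota := iota)) => // x xP; rewrite rootE //.
have [//|x1] := eqVneq x 1; apply/idP/eqP => [|xp]; last first.
  apply/eqP/(indicator_sum_fixed_order_p p_prime p_odd m_ge1 r_ge1 p_er g0_ord
    chi_mod chi0 chi_pr K2 xp aE).
  by rewrite -two_a; apply/eqP.
apply: contraTeq => xp.
have P_gt0 : (0 < p ^ m)%N by rewrite expn_gt0 p_gt0.
have [n x_prim] := prim_order_exists P_gt0 xP.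
case/(dvdn_pfactor _ _ p_prime) => k lekm nE; rewrite nE in x_prim.
have k_gt1 : (1 < k)%N.
  rewrite ltnNge; apply: contraNN xp => lek1.
  by rewrite -(prim_order_dvd x_prim) -{2}[p]expn1 dvdn_exp2l.
apply: (indicator_sum_not_fixed_ramified p_prime p_odd m_ge1 r_ge1 p_er g0_ord
  chi_mod chi0 chi_pr K2 _ x_prim aE two_p two_p2).
by rewrite k_gt1.
Qed.
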